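(* For every integer $n\ge 0$, $$\mathrm{LS}_n(112)=\mathrm{LS}_n(121)=\mathrm{RB}_n(121)=\mathrm{RB}_n(122)=\prod_{i=1}^{n-1}(1+q^i).$$
   Context: A restricted growth function (RGF) of length $n$ is a sequence $w=w_1\dots w_n$ of positive integers with $w_1=1$ and $w_i\le 1+\max\{w_1,\dots,w_{i-1}\}$ for $i\ge 2$ ($R_0$ consists of the empty word); $R_n$ is the set of RGFs of length $n$. The standardization of a word replaces every occurrence of its smallest letter by $1$, of its next smallest letter by $2$, and so on. An RGF $w$ contains an RGF $v$ if some subword (subsequence, not necessarily consecutive) of $w$ standardizes to $v$; otherwise $w$ avoids $v$. $R_n(v)$ is the set of $w\in R_n$ avoiding $v$. For a word $w$ and position $j$: $\mathrm{ls}(w_j)$ is the number of distinct values $w_i$ with $i<j$ and $w_i<w_j$; $\mathrm{rb}(w_j)$ is the number of distinct values $w_i$ with $i>j$ and $w_i>w_j$; $\mathrm{ls}(w)=\sum_j\mathrm{ls}(w_j)$, $\mathrm{rb}(w)=\sum_j\mathrm{rb}(w_j)$. Then $\mathrm{LS}_n(v)=\sum_{w\in R_n(v)}q^{\mathrm{ls}(w)}$ and $\mathrm{RB}_n(v)=\sum_{w\in R_n(v)}q^{\mathrm{rb}(w)}$. *)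

(* Defs.v *)
From HB Require Import structures.
From mathcomp Require Import all_boot all_order all_algebra.

Set Implicit Arguments.
Unset Strict Implicit.
Unset Printing Implicit Defensive.

Import GRing.Theory.

(* Words are sequences of naturals.  Positions are counted from 0, so that the
   letter w_j of the mathematical notation is [nth 0 w j.-1]. *)

(* The default value 1 of [head] makes the empty word an RGF. *)
Definition is_rgf (w : seq nat) : bool :=
  [&& all (fun x => 0 < x) w,
      head 1 w == 1
    & [forall i : 'I_(size w),
         (0 < i) ==> (nth 0 w i <= 1 + \max_(x <- take i w) x)]].

Definition standardize (w : seq nat) : seq nat :=
  [seq (index x (sort leq (undup w))).+1 | x <- w].

(* The subwords of w are the sequences [mask m w] for m a selection of
   positions of w. *)
Definition contains (w v : seq nat) : bool :=
  [exists m : (size w).-tuple bool, standardize (mask m w) == v].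

Definition avoids (w v : seq nat) : bool := ~~ contains w v.

Definition ls_at (w : seq nat) (j : nat) : nat :=
  size (undup [seq x <- take j w | x < nth 0 w j]).

Definition rb_at (w : seq nat) (j : nat) : nat :=
  size (undup [seq x <- drop j.+1 w | nth 0 w j < x]).

Definition ls (w : seq nat) : nat := \sum_(j < size w) ls_at w j.

Definition rb (w : seq nat) : nat := \sum_(j < size w) rb_at w j.

Lemma rgf_le_size (w : seq nat) (x : nat) :
  is_rgf w -> x \in w -> x <= size w.
Proof.
case/and3P=> _ h1 /forallP hmax.
have bnd i : i < size w -> nth 0 w i <= i.+1.
  elim/ltn_ind: i => i IH lti.
  have [i0|ipos] := posnP i.
    by rewrite i0; case: (w) h1 => //= a s /eqP->.
  apply: leq_trans (implyP (hmax (Ordinal lti)) ipos) _; rewrite add1n ltnS /=.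
  apply/bigmax_leqP_seq => y /(nthP 0)[k]; rewrite size_take lti => ltk <- _.
  by rewrite nth_take //; apply: leq_trans (IH k ltk (ltn_trans ltk lti)) ltk.
by move=> /(nthP 0)[i lti <-]; apply: leq_trans (bnd i lti) lti.
Qed.

Definition word (n : nat) (w : n.-tuple 'I_n.+1) : seq nat :=
  [seq nat_of_ord x | x <- w].

(* By [rgf_le_size], the letters of an RGF of length n are at most n, so that
   bounding the letters by n omits no RGF. *)
Definition R (n : nat) (v : seq nat) : {set n.-tuple 'I_n.+1} :=
  [set w | is_rgf (word w) && avoids (word w) v].

Local Open Scope ring_scope.

Definition LS (n : nat) (v : seq nat) : {poly int} :=
  \sum_(w in R n v) 'X^(ls (word w)).

Definition RB (n : nat) (v : seq nat) : {poly int} :=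
  \sum_(w in R n v) 'X^(rb (word w)).

(* Main.v *)
(* Each of the four classes P consists, in length n >= 1, of exactly 2^(n-1)
   words: every word of P of length k+1 >= 2 arises in a unique way from a word w
   of P of length k, either by a step g0 preserving the statistic or by a step g1
   increasing it by k.  Hence the generating function gains a factor 1 + q^k.
   With m = max w and w+1 the word w with all letters increased by 1, the steps are
     LS(112):  g0 w = w 1         g1 w = 1 (w+1)
     LS(121):  g0 w = 1 w         g1 w = 1 (w+1)
     RB(121):  g0 w = w m         g1 w = w (m+1)
     RB(122):  g0 w = w 1         g1 w = w (m+1).
   For LS one uses that ls w is the sum of the w_j - 1 when w is an RGF.  For RB,
   appending a new maximum increases every rb(w_j) by 1. *)

Require Import Defs.
From HB Require Import structures.
From mathcomp Require Import all_boot all_order all_algebra.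
From mathcomp Require Import zify.

Set Implicit Arguments.
Unset Strict Implicit.
Unset Printing Implicit Defensive.

Import GRing.Theory.
Local Open Scope ring_scope.

Local Open Scope nat_scope.

(** * Containment of patterns of length three *)

Lemma containsP (w v : seq nat) :
  reflect (exists2 u, subseq u w & standardize u = v) (contains w v).
Proof.
apply: (iffP existsP) => [[m /eqP <-]|[u /subseqP[m sz_m ->] <-]].
  by exists (mask m w) => //; apply: mask_subseq.
by exists (@Tuple _ _ m (introT eqP sz_m)).
Qed.

(** Each letter is replaced by its index in the strictly increasing list of the distinct letters,
    and [index] is monotone on such a list. *)
Lemma ltn_standardize (u : seq nat) (i j : nat) : i < size u -> j < size u ->
  (nth 0 (standardize u) i < nth 0 (standardize u) j) = (nth 0 u i < nth 0 u j).
Proof.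
move=> lti ltj; rewrite !(nth_map 0) // ltnS.
set s := sort leq (undup u).
have s_sorted : sorted leq s by apply: sort_sorted; apply: leq_total.
have s_lt : sorted ltn s by rewrite ltn_sorted_uniq_leq sort_uniq undup_uniq.
have mem_s k : k < size u -> nth 0 u k \in s.
  by move=> ltk; rewrite mem_sort mem_undup mem_nth.
apply/idP/idP.
  by apply: (sorted_ltn_index ltn_trans s_lt); apply: mem_s.
apply: contraTT; rewrite -!leqNgt.
by apply: (sorted_leq_index leq_trans leqnn s_sorted); apply: mem_s.
Qed.

(** Both directions of each comparison are recorded, so that equality of two letters can be read off
    from the failure of both. *)
Lemma standardize3P (u : seq nat) (a b c : nat) : standardize u = [:: a; b; c] ->
  exists x y z, [/\ u = [:: x; y; z], (x < y) = (a < b), (y < x) = (b < a),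
    (y < z) = (b < c) & (z < y) = (c < b)] /\ (x < z) = (a < c) /\ (z < x) = (c < a).
Proof.
case: u => [|x [|y [|z [|? ?]]]] // st_u; exists x, y, z.
have lt_st i j := @ltn_standardize [:: x; y; z] i j.
rewrite st_u in lt_st.
by have := (lt_st 0 1, lt_st 1 0, lt_st 1 2, lt_st 2 1, lt_st 0 2, lt_st 2 0) => /=;
  do 5![case]; do !move/(_ isT isT) => ->.
Qed.

Lemma avoids112P (w : seq nat) :
  reflect (forall a b, a < b -> ~~ subseq [:: a; a; b] w) (avoids w [:: 1; 1; 2]).
Proof.
apply: (iffP idP) => [av a b ltab|av].
  apply: contra av => sub; apply/containsP; exists [:: a; a; b] => //.
  rewrite /standardize /= !inE eqxx /= (ltn_eqF ltab) /sort /=.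
  by rewrite (ltnW ltab) /= !eqxx (ltn_eqF ltab).
apply/containsP => -[u sub /standardize3P[x [y [z [[def_u xy yx yz _] _]]]]].
have def_y : y = x by lia.
by case/negP: (av y z yz); rewrite {1}def_y -def_u.
Qed.

Lemma avoids122P (w : seq nat) :
  reflect (forall a b, a < b -> ~~ subseq [:: a; b; b] w) (avoids w [:: 1; 2; 2]).
Proof.
apply: (iffP idP) => [av a b ltab|av].
  apply: contra av => sub; apply/containsP; exists [:: a; b; b] => //.
  rewrite /standardize /= !inE eqxx (ltn_eqF ltab) /= /sort /=.
  by rewrite (ltnW ltab) /= !eqxx (ltn_eqF ltab).
apply/containsP => -[u sub /standardize3P[x [y [z [[def_u xy yx yz zy] _]]]]].
have def_z : z = y by lia.
by case/negP: (av x y xy); rewrite -{2}def_z -def_u.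
Qed.

Lemma avoids121P (w : seq nat) :
  reflect (forall a b, a < b -> ~~ subseq [:: a; b; a] w) (avoids w [:: 1; 2; 1]).
Proof.
apply: (iffP idP) => [av a b ltab|av].
  apply: contra av => sub; apply/containsP; exists [:: a; b; a] => //.
  rewrite /standardize /= !inE eqxx (gtn_eqF ltab) orbT /= /sort /=.
  by rewrite leqNgt ltab /= !eqxx (ltn_eqF ltab).
apply/containsP => -[u sub /standardize3P[x [y [z [[def_u xy _ _ _] [xz zx]]]]]].
have def_z : z = x by lia.
by case/negP: (av x y xy); rewrite -{2}def_z -def_u.
Qed.

Lemma avoids_subseq (u w v : seq nat) : subseq u w -> avoids w v -> avoids u v.
Proof.
move=> sub_uw; apply: contra => /containsP[t sub_tu st_t]; apply/containsP.
by exists t => //; apply: subseq_trans sub_uw.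
Qed.

(** * Building RGFs by appending letters *)

Lemma is_rgf_nil : is_rgf [::].
Proof. by rewrite /is_rgf /=; apply/forallP => -[]. Qed.

(** This replaces the positional definition by a recursion on the last letter. For empty [w] the
    maximum is 0, and the bound forces [x = 1], in agreement with the condition on the head. *)
Lemma is_rgf_rcons (w : seq nat) (x : nat) :
  is_rgf (rcons w x) = is_rgf w && (0 < x <= (\max_(y <- w) y).+1).
Proof.
rewrite /is_rgf all_rcons size_rcons -!andbA.
have [->|w_neq0] := eqVneq w [::].
  rewrite /=.
  have -> : [forall i : 'I_1, (0 < i) ==>
      (nth 0 [:: x] i <= 1 + \max_(z <- take i [:: x]) z)] by apply/forallP => -[[]].
  have -> : [forall i : 'I_0, (0 < i) ==>
      (nth 0 [::] i <= 1 + \max_(z <- [::]) z)] by apply/forallP => -[].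
  by rewrite big_nil; case: x => [|[]].
have -> : head 1 (rcons w x) = head 1 w by case: w w_neq0.
have -> : [forall i : 'I_(size w).+1, (0 < i) ==>
    (nth 0 (rcons w x) i <= 1 + \max_(y <- take i (rcons w x)) y)] =
  [forall i : 'I_(size w), (0 < i) ==> (nth 0 w i <= 1 + \max_(y <- take i w) y)]
    && (x <= (\max_(y <- w) y).+1).
  have prefixE i : i < size w -> (nth 0 (rcons w x) i = nth 0 w i) *
      (take i (rcons w x) = take i w).
    by move=> lti; rewrite nth_rcons lti -cats1 takel_cat // ltnW.
  apply/forallP/andP => [rgf_wx|[/forallP rgf_w le_x] i].
    split.
      apply/forallP => i; have := rgf_wx (widen_ord (leqnSn _) i).
      by rewrite /= !prefixE.
    have := rgf_wx ord_max; rewrite /= nth_rcons ltnn eqxx -cats1 take_size_cat //.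
    by rewrite add1n lt0n size_eq0 w_neq0.
  have [lti|] := ltnP i (size w); first by have := rgf_w (Ordinal lti); rewrite /= !prefixE.
  move=> lei; have -> : i = size w :> nat by apply/eqP; rewrite eqn_leq lei -ltnS ltn_ord.
  by rewrite nth_rcons ltnn eqxx -cats1 take_size_cat // add1n le_x implybT.
by case: (0 < x); case: (all _ w); case: (head 1 w == 1); rewrite ?andbF ?andbT.
Qed.

Lemma rgf_gt0 (w : seq nat) (x : nat) : is_rgf w -> x \in w -> 0 < x.
Proof. by case/and3P => /allP w_gt0 _ _ /w_gt0. Qed.

Lemma rgf_cons (w : seq nat) : is_rgf w -> w != [::] -> exists s, w = 1 :: s.
Proof. by case/and3P => _ + _; case: w => //= x s /eqP -> _; exists s. Qed.

(** An appended letter exceeds the current maximum by at most one, so no value is ever skipped. *)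
Lemma rgf_mem (w : seq nat) (x : nat) :
  is_rgf w -> (x \in w) = (0 < x <= \max_(y <- w) y).
Proof.
move=> rgf_w; apply/idP/idP => [w_x|].
  by rewrite (rgf_gt0 rgf_w) // (leq_bigmax_seq (F := id)).
elim/last_ind: w rgf_w => [|w y IHw]; first by rewrite big_nil; case: x.
rewrite is_rgf_rcons => /andP[rgf_w /andP[y_gt0 le_y]] /andP[x_gt0].
rewrite -cats1 big_cat big_seq1 /= mem_cat inE.
have [|lt_x le_x] := leqP x (\max_(z <- w) z); first by rewrite x_gt0 in IHw * => /IHw ->.
by apply/orP; right; lia.
Qed.

(** * The two statistics when a letter is appended *)

Lemma ls_rcons (w : seq nat) (x : nat) :
  ls (rcons w x) = ls w + size (undup [seq y <- w | y < x]).
Proof.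
rewrite /ls size_rcons big_ord_recr /= /ls_at nth_rcons ltnn eqxx -cats1.
rewrite take_size_cat //; congr (_ + _); apply: eq_bigr => i _.
by rewrite cats1 nth_rcons ltn_ord -cats1 takel_cat // ltnW.
Qed.

(** By [rgf_mem], all of 1, ..., x-1 already occur when x is appended, so x contributes exactly
    x-1. *)
Lemma ls_rgf (w : seq nat) : is_rgf w -> ls w = \sum_(x <- w) x.-1.
Proof.
elim/last_ind: w => [|w x IHw]; first by rewrite /ls big_ord0 big_nil.
rewrite is_rgf_rcons => /andP[rgf_w /andP[x_gt0 le_x]].
rewrite ls_rcons IHw // -cats1 big_cat big_seq1; congr (_ + _).
rewrite -[RHS](size_iota 1); apply/perm_size/uniq_perm => [||y].
- exact: undup_uniq.
- exact: iota_uniq.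
by rewrite mem_undup mem_filter mem_iota rgf_mem //; lia.
Qed.

Lemma rb_at_rcons (w : seq nat) (x i : nat) : i < size w ->
  rb_at (rcons w x) i = rb_at w i + ((nth 0 w i < x) && (x \notin drop i.+1 w)).
Proof.
move=> lti; rewrite /rb_at drop_rcons // nth_rcons lti filter_rcons.
case: ifP => [lt_x|_]; last by rewrite addn0.
rewrite (perm_size (perm_undup (mem_rcons _ x))) /= mem_filter lt_x /=.
by case: (x \in _); rewrite ?addn0 ?addn1.
Qed.

Lemma rb_rcons (w : seq nat) (x : nat) : rb (rcons w x) =
  rb w + \sum_(i < size w) ((nth 0 w i < x) && (x \notin drop i.+1 w)).
Proof.
rewrite /rb size_rcons big_ord_recr /= [X in _ + X]/rb_at.
rewrite drop_oversize ?size_rcons //= addn0 -big_split.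
by apply: eq_bigr => i _; apply: rb_at_rcons.
Qed.

Lemma rb_rcons_gt (w : seq nat) (x : nat) :
  {in w, forall y, y < x} -> rb (rcons w x) = rb w + size w.
Proof.
move=> ltx; rewrite rb_rcons (eq_bigr (fun=> 1)) => [|i _].
  by rewrite sum_nat_const card_ord muln1.
rewrite ltx ?mem_nth //=.
by have [/mem_drop/ltx|//] := boolP (x \in _); rewrite ltnn.
Qed.

Lemma rb_rcons_le (w : seq nat) (x : nat) :
  {in w, forall y, x <= y} -> rb (rcons w x) = rb w.
Proof.
move=> lex; rewrite rb_rcons big1 ?addn0 // => i _.
by rewrite ltnNge lex ?mem_nth.
Qed.

(** The positions before the first of the two final letters already see the value [x] to their
    right, and that letter itself is not smaller than [x]. *)
Lemma rb_rcons_last (w : seq nat) (x : nat) : rb (rcons (rcons w x) x) = rb (rcons w x).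
Proof.
rewrite rb_rcons big1 ?addn0 // => -[i /=]; rewrite size_rcons ltnS => lei _.
have [lti|gei] := ltnP i (size w).
  by rewrite drop_rcons // mem_rcons mem_head andbF.
have -> : i = size w by apply/eqP; rewrite eqn_leq lei.
by rewrite nth_rcons ltnn eqxx ltnn.
Qed.

(** * Classes generated by two steps *)

Lemma avoids_size_le1 (w v : seq nat) : size w <= 1 -> 1 < size v -> avoids w v.
Proof.
move=> w_le1; apply: contraTN => /containsP[u /size_subseq le_uw <-].
by rewrite size_map -leqNgt (leq_trans le_uw).
Qed.

Lemma rgf_word (u : seq nat) : is_rgf u ->
  exists w : (size u).-tuple 'I_(size u).+1, word w = u.
Proof.
move=> rgf_u; exists (map_tuple inord (in_tuple u)).
rewrite /word /= -map_comp map_id_in // => x u_x /=.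
by rewrite inordK // ltnS rgf_le_size.
Qed.

Definition rgf_avoiding (v w : seq nat) : bool := is_rgf w && avoids w v.

(** Round [k] holds words of length [k.+1]. The start is the word 1, because on the empty word the
    steps used below either coincide or leave the class. *)
Definition words_by_steps (g0 g1 : seq nat -> seq nat) (k : nat) : seq (seq nat) :=
  iter k (fun s => map g0 s ++ map g1 s) [:: [:: 1]].

Section RecursiveClass.

Variables (v : seq nat) (st : seq nat -> nat) (g0 g1 : seq nat -> seq nat).

Local Notation P := (rgf_avoiding v).

Hypothesis v_gt1 : 1 < size v.
Hypotheses (st_nil : st [::] = 0) (st_1 : st [:: 1] = 0).
Hypotheses (size_g0 : forall w, size (g0 w) = (size w).+1)
           (size_g1 : forall w, size (g1 w) = (size w).+1).
Hypotheses (g0_inj : injective g0) (g1_inj : injective g1).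
(** Disjointness of the images is asked within the class only: for LS(112), the non-RGF [[:: 0]] has
    [g1 [:: 0] = g0 [:: 1]]. *)
Hypothesis g01_neq : forall w s, w != [::] -> P w -> P s -> g1 s <> g0 w.
Hypotheses (P_g0 : forall w, w != [::] -> P w -> P (g0 w))
           (P_g1 : forall w, w != [::] -> P w -> P (g1 w)).
Hypothesis P_split : forall w, 1 < size w -> P w ->
  exists2 s, P s & w = g0 s \/ w = g1 s.
Hypotheses (st_g0 : forall w, w != [::] -> P w -> st (g0 w) = st w)
           (st_g1 : forall w, w != [::] -> P w -> st (g1 w) = st w + size w).

Lemma mem_words_by_steps (k : nat) (w : seq nat) :
  (w \in words_by_steps g0 g1 k) = (size w == k.+1) && P w.
Proof.
elim: k w => [|k IHk] w.
  rewrite /= inE; apply/eqP/andP => [->|[/eqP sz_w /andP[/rgf_cons rgf_w _]]].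
    rewrite /rgf_avoiding avoids_size_le1 // andbT -[[:: 1]]/(rcons [::] 1) is_rgf_rcons.
    by rewrite is_rgf_nil big_nil.
  by case: w sz_w rgf_w => [|x []] // _ [] // s [-> _].
rewrite /= mem_cat; apply/orP/andP.
  case=> /mapP[s]; rewrite IHk => /andP[/eqP sz_s Ps] ->.
    by rewrite size_g0 sz_s P_g0 // -size_eq0 sz_s.
  by rewrite size_g1 sz_s P_g1 // -size_eq0 sz_s.
case=> /eqP sz_w Pw; have [|s Ps def_w] := P_split _ Pw; first by rewrite sz_w.
have sz_s : size s = k.+1.
  by case: def_w sz_w => ->; rewrite ?size_g0 ?size_g1 => -[].
case: def_w => ->; [left|right]; apply: map_f; rewrite IHk sz_s Ps eqxx //.
Qed.

Lemma uniq_words_by_steps (k : nat) : uniq (words_by_steps g0 g1 k).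
Proof.
elim: k => // k IHk; rewrite /= cat_uniq !map_inj_uniq // IHk andbT /=.
apply/hasPn => _ /mapP[s s_k ->]; apply/mapP => -[w w_k].
move: s_k w_k; rewrite !mem_words_by_steps => /andP[_ Ps] /andP[/eqP sz_w Pw].
by apply: g01_neq; rewrite // -size_eq0 sz_w.
Qed.

Lemma gf_words_by_steps (k : nat) : (\sum_(w <- words_by_steps g0 g1 k) 'X^(st w) =
  \prod_(1 <= i < k.+1) (1 + 'X^i) :> {poly int})%R.
Proof.
elim: k => [|k IHk]; first by rewrite big_seq1 st_1 big_geq.
(* The words of round [k] have length [k.+1], so [g1] multiplies each monomial by the power of ['X]
   in the new factor. *)
rewrite big_nat_recr //= -IHk big_cat !big_map mulrDr mulr1 mulr_suml.
by congr (_ + _)%R; rewrite [LHS]big_seq [RHS]big_seq; apply: eq_bigr => w;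
  rewrite mem_words_by_steps => /andP[/eqP sz_w Pw];
  rewrite ?st_g0 ?st_g1 -?size_eq0 ?sz_w // exprD.
Qed.

Lemma gf_recursive_class (n : nat) :
  (\sum_(w in R n v) 'X^(st (word w)) =
    \prod_(1 <= i < n) (1 + 'X^i) :> {poly int})%R.
Proof.
case: n => [|k].
  rewrite [RHS]big_geq // (big_pred1 [tuple]) ?st_nil // => w.
  rewrite inE /= (tuple0 w) [RHS]eqxx avoids_size_le1 // andbT.
  exact: is_rgf_nil.
(* The sum over bounded tuples becomes a sum over their underlying words. It then suffices that two
   duplicate-free lists have the same members. *)
rewrite -gf_words_by_steps -[LHS]big_enum -[LHS](big_map _ xpredT (fun u => 'X^(st u))%R).
apply/perm_big/uniq_perm => [||u]; last 1 first.
- rewrite mem_words_by_steps; apply/mapP/andP => [[w]|[/eqP sz_u Pu]].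
    by rewrite mem_enum inE => Pw ->; rewrite size_map size_tuple eqxx.
  have [/= rgf_u _] := andP Pu.
  have [w def_u] := rgf_word rgf_u; move: w def_u; rewrite sz_u => w def_u.
  by exists w; rewrite // mem_enum inE -/(rgf_avoiding _ _) def_u.
- rewrite map_inj_uniq ?enum_uniq // => w s /(inj_map val_inj).
  exact: val_inj.
exact: uniq_words_by_steps.
Qed.

End RecursiveClass.

(** * Appending to avoiding words, and the pattern 122 *)

(** Greedy matching from the right: when [x] is appended to an avoiding word, a copy of the pattern
    must end in [x], and the rest of the copy lies in [w]. *)
Lemma subseq_rcons2 (T : eqType) (s w : seq T) (x y : T) :
  subseq (rcons s y) (rcons w x) = subseq (if y == x then s else rcons s y) w.
Proof.
rewrite -subseq_rev !rev_rcons /=.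
by case: eqP => _; rewrite -?rev_rcons subseq_rev.
Qed.

Lemma rgf_avoiding_prefix (v w : seq nat) (x : nat) :
  rgf_avoiding v (rcons w x) -> rgf_avoiding v w.
Proof.
rewrite /rgf_avoiding is_rgf_rcons => /andP[/andP[-> _]] /=.
exact/avoids_subseq/subseq_rcons.
Qed.

Lemma rgf_max_gt0 (w : seq nat) :
  is_rgf w -> w != [::] -> 0 < \max_(x <- w) x.
Proof. by move=> rgf_w /rgf_cons[//|s ->]; rewrite big_cons leq_max. Qed.

(** A last letter [x] that is neither 1 nor a new maximum already occurs in the prefix, and with the
    leading 1 it forms a copy [1 x x] of 122. Hence the two steps exhaust the class. *)
Lemma rb_gf_122 (n : nat) :
  (RB n [:: 1; 2; 2]%N = \prod_(1 <= i < n) (1 + 'X^i))%R.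
Proof.
apply: (@gf_recursive_class _ _ (rcons^~ 1) (fun w => rcons w (\max_(x <- w) x).+1)).
- by [].
- by rewrite /rb big_ord0.
- by rewrite /rb big_ord1.
- by move=> w; rewrite size_rcons.
- by move=> w; rewrite size_rcons.
- by move=> w s /rcons_inj[].
- by move=> w s /rcons_inj[].
- move=> w s w_neq0 /andP[rgf_w _] _ /rcons_inj[-> max_w].
  by have := rgf_max_gt0 rgf_w w_neq0; rewrite max_w.
- move=> w w_neq0 /andP[rgf_w /avoids122P av_w]; rewrite /rgf_avoiding is_rgf_rcons rgf_w /=.
  apply/avoids122P => a b ltab; rewrite (subseq_rcons2 [:: a; b]).
  case: eqP => [b1|_]; last exact: av_w.
  (* A final 1 would have to play the larger letter, so the smaller one would be 0. *)
  apply/negP => /mem_subseq/(_ a (mem_head _ _))/(rgf_gt0 rgf_w); lia.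
- move=> w w_neq0 /andP[rgf_w /avoids122P av_w]; rewrite /rgf_avoiding is_rgf_rcons rgf_w ltnSn /=.
  apply/avoids122P => a b ltab; rewrite (subseq_rcons2 [:: a; b]).
  case: eqP => [->|_]; last exact: av_w.
  (* The new maximum has no earlier occurrence to serve as the first of the two equal letters. *)
  apply/negP => /mem_subseq/(_ _ (mem_last _ _)) /=.
  by rewrite rgf_mem // ltnn.
- case/lastP => // w x; rewrite size_rcons ltnS lt0n size_eq0 => w_neq0 Pwx.
  exists w; first exact: rgf_avoiding_prefix Pwx.
  move: Pwx; rewrite /rgf_avoiding is_rgf_rcons => /andP[/andP[rgf_w /andP[x_gt0 le_x]]].
  move=> /avoids122P av_wx; have [->|x_neq1] := eqVneq x 1; [by left|right].
  move: le_x; rewrite leq_eqVlt => /predU1P[->//|lt_x].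
  have w_x : x \in w by rewrite rgf_mem // x_gt0.
  have x_gt1 : 1 < x by lia.
  case/negP: (av_wx 1 x x_gt1); rewrite (subseq_rcons2 [:: 1; x]) eqxx.
  have [s def_w] := rgf_cons rgf_w w_neq0; move: w_x.
  by rewrite def_w inE (negPf x_neq1) /= sub1seq.
- by move=> w _ /andP[rgf_w _]; apply: rb_rcons_le => y; apply: rgf_gt0.
- move=> w _ /andP[rgf_w _]; apply: rb_rcons_gt => y w_y.
  by rewrite ltnS (leq_bigmax_seq (F := id)).
Qed.

(** * Shifting an RGF, and the pattern 112 *)

Lemma ls_map_succ (w : seq nat) :
  is_rgf w -> is_rgf (1 :: map succn w) -> ls (1 :: map succn w) = ls w + size w.
Proof.
move=> rgf_w rgf_w'; rewrite !ls_rgf // big_cons big_map /= add0n.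
rewrite -sum1_size -big_split /= !big_seq; apply: eq_bigr => x w_x.
by rewrite addn1 prednK // (rgf_gt0 rgf_w).
Qed.

Lemma ls_cons1 (w : seq nat) : is_rgf w -> is_rgf (1 :: w) -> ls (1 :: w) = ls w.
Proof. by move=> rgf_w rgf_w'; rewrite !ls_rgf // big_cons. Qed.

Lemma ls_rcons1 (w : seq nat) : is_rgf w -> is_rgf (rcons w 1) -> ls (rcons w 1) = ls w.
Proof.
by move=> rgf_w rgf_w'; rewrite !ls_rgf // -cats1 big_cat big_seq1 /= addn0.
Qed.

(** Shifting behind a leading 1 raises the maximum by exactly one, even for empty [w]. Positivity is
    stated separately because the shift hides a letter 0: [[:: 1; 1]] is an RGF and [[:: 0]] is
    not. *)
Lemma is_rgf_map_succ (w : seq nat) :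
  is_rgf w = is_rgf (1 :: map succn w) && all (leq 1) w.
Proof.
elim/last_ind: w => [|w x IHw].
  by rewrite /= andbT -[[:: 1]]/(rcons [::] 1) is_rgf_rcons is_rgf_nil big_nil.
rewrite map_rcons -rcons_cons all_rcons !is_rgf_rcons IHw.
have -> : \max_(y <- 1 :: map succn w) y = (\max_(y <- w) y).+1.
  rewrite big_cons big_map; elim: (w) => [|y s IHs]; first by rewrite !big_nil.
  by rewrite !big_cons maxnCA IHs maxnSS.
rewrite ltnS /=; case: (is_rgf _) => //=.
by case: (all _ w); case: (0 < x); rewrite ?andbF ?andbT.
Qed.

(** If the last letter is 1, removing it undoes [g0]. If it is some [x > 1], a second 1 would give a
    copy [1 1 x] of 112, so every letter after the first is at least 2, and deleting the leading 1
    and lowering the rest undoes [g1]. *)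
Lemma ls_gf_112 (n : nat) :
  (LS n [:: 1; 1; 2]%N = \prod_(1 <= i < n) (1 + 'X^i))%R.
Proof.
have rgf_g1 w : is_rgf w -> is_rgf (1 :: map succn w).
  by rewrite is_rgf_map_succ => /andP[].
have rgf_g0 w : is_rgf w -> is_rgf (rcons w 1) by rewrite is_rgf_rcons => ->.
apply: (@gf_recursive_class _ _ (rcons^~ 1) (fun w => 1 :: map succn w)).
- by [].
- by rewrite /ls big_ord0.
- by rewrite /ls big_ord1.
- by move=> w; rewrite size_rcons.
- by move=> w; rewrite /= size_map.
- by move=> w s /rcons_inj[].
- by move=> w s [] /(inj_map succn_inj).
- move=> w s w_neq0 /andP[rgf_w _] /andP[rgf_s _].
  have [t ->] := rgf_cons rgf_w w_neq0; rewrite rcons_cons => -[def_t].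
  have: 1 \in map succn s by rewrite def_t mem_rcons mem_head.
  by rewrite (mem_map succn_inj) => /(rgf_gt0 rgf_s).
- move=> w _ /andP[rgf_w /avoids112P av_w]; rewrite /rgf_avoiding rgf_g0 //=.
  apply/avoids112P => a b ltab; rewrite (subseq_rcons2 [:: a; a]).
  case: eqP => [b1|_]; last exact: av_w.
  apply/negP => /mem_subseq/(_ a (mem_head _ _))/(rgf_gt0 rgf_w); lia.
- move=> w _ /andP[rgf_w /avoids112P av_w]; rewrite /rgf_avoiding rgf_g1 //=.
  apply/avoids112P => -[|a] [|b] // ltab.
    by apply/negP => /mem_subseq/(_ _ (mem_head _ _))/(rgf_gt0 (rgf_g1 _ rgf_w)).
  rewrite -[_ :: _]/(succn a :: map succn [:: a; b]).
  (* A copy that uses the leading 1 needs a second 1, which would come from a letter 0 of [w]. Any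
     other copy lies in the shifted part and can be lowered to one in [w]. *)
  rewrite /= eqSS; case: eqP => [->|_].
    apply/negP => /mem_subseq/(_ _ (mem_head _ _)).
    by rewrite (mem_map succn_inj) => /(rgf_gt0 rgf_w).
  apply: contra (av_w a b ltab) => /subseqP[m]; rewrite size_map => sz_m.
  rewrite -map_mask -[_ :: _]/(map succn [:: a; a; b]) => /(inj_map succn_inj) ->.
  exact: mask_subseq.
- case/lastP => // w x; rewrite size_rcons ltnS lt0n size_eq0 => w_neq0 Pwx.
  have Pw := rgf_avoiding_prefix Pwx.
  have [rgf_w _] := andP Pw; have [rgf_wx /avoids112P av_wx] := andP Pwx.
  have [->|x_neq1] := eqVneq x 1; first by exists w => //; left.
  have [t def_w] := rgf_cons rgf_w w_neq0.
  have x_gt1 : 1 < x.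
    have wx_x : x \in rcons w x by rewrite mem_rcons mem_head.
    by have := rgf_gt0 rgf_wx wx_x; lia.
  have t1F : 1 \notin t.
    apply: contra (av_wx 1 x x_gt1) => t1.
    by rewrite (subseq_rcons2 [:: 1; 1]) eqxx def_w /= sub1seq.
  (* The predecessor [s] is the lowered tail; it stays positive because 1 does not occur in that
     tail. *)
  have [s def_s s_gt0] : exists2 s, map succn s = rcons t x & all (leq 1) s.
    exists (map predn (rcons t x)).
      rewrite -map_comp map_id_in // => y t_y /=; rewrite prednK //.
      by apply: (rgf_gt0 rgf_wx); rewrite def_w inE t_y orbT.
    apply/allP => _ /mapP[y t_y ->]; have: y != 1.
      by apply: contraTneq t_y => ->; rewrite mem_rcons inE eq_sym negb_or x_neq1.
    have: 0 < y by apply: (rgf_gt0 rgf_wx); rewrite def_w inE t_y orbT.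
    by case: y {t_y} => [|[]].
  exists s; last by right; rewrite def_s def_w.
  apply/andP; split; first by rewrite is_rgf_map_succ def_s s_gt0 andbT -rcons_cons -def_w.
  apply/avoids112P => a b ltab; apply: contra (av_wx a.+1 b.+1 ltab).
  move/(map_subseq succn); rewrite def_s def_w => /subseq_trans -> //.
  exact: subseq_cons.
- by move=> w _ /andP[rgf_w _]; apply: ls_rcons1; rewrite ?rgf_g0.
- by move=> w _ /andP[rgf_w _]; apply: ls_map_succ; rewrite ?rgf_g1.
Qed.

(** * The pattern 121 *)

Definition unit_step (x y : nat) : bool := x <= y <= x.+1.

Lemma sorted_rcons2 (T : eqType) (e : rel T) (w : seq T) (x y : T) :
  sorted e (rcons (rcons w x) y) = sorted e (rcons w x) && e x y.
Proof. by case: w => [|z w] /=; rewrite ?andbT // rcons_path last_rcons. Qed.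

Lemma max_unit_steps (w : seq nat) :
  sorted unit_step w -> \max_(x <- w) x = last 0 w.
Proof.
elim/last_ind: w => [|w y IHw]; first by rewrite big_nil.
case/lastP: w IHw => [|w x] IHw; first by rewrite big_seq1.
rewrite sorted_rcons2 -(cats1 (rcons w x)) big_cat big_seq1 /= => /andP[/IHw -> /andP[lexy _]].
by rewrite cats1 !last_rcons; apply/maxn_idPr.
Qed.

(** Let [l] be the last letter, which is the maximum so far. Appending a positive [x < l] creates a
    copy [x l x] of 121, since [x] already occurs. Appending [l] or [l + 1] creates none, since no
    earlier letter exceeds the new one. The default of [head] admits the empty word. *)
Lemma rgf_avoiding_121 (w : seq nat) :
  rgf_avoiding [:: 1; 2; 1] w = (head 1 w == 1) && sorted unit_step w.
Proof.
elim/last_ind: w => [|w x IHw]; first by rewrite /rgf_avoiding is_rgf_nil avoids_size_le1.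
case/lastP: w IHw => [_|w l IHw].
  rewrite /rgf_avoiding avoids_size_le1 // is_rgf_rcons is_rgf_nil big_nil.
  by case: x => [|[]].
have -> : head 1 (rcons (rcons w l) x) = head 1 (rcons w l) by case: w {IHw}.
rewrite sorted_rcons2 andbA -IHw.
have [Pw|nPw] := boolP (rgf_avoiding _ (rcons w l)); last first.
  by apply: contraNF nPw; apply: rgf_avoiding_prefix.
have [rgf_w /avoids121P av_w] := andP Pw.
have max_w : \max_(y <- rcons w l) y = l.
  by move: Pw; rewrite IHw => /andP[_ /max_unit_steps->]; rewrite last_rcons.
have l_gt0 : 0 < l by apply: (rgf_gt0 rgf_w); rewrite mem_rcons mem_head.
rewrite /rgf_avoiding is_rgf_rcons rgf_w max_w /= /unit_step.
apply/andP/andP => [[/andP[x_gt0 ->] /avoids121P av_wx]|[lelx lexl]].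
  split=> //; rewrite leqNgt; apply/negP => ltxl; case/negP: (av_wx x l ltxl).
  rewrite (subseq_rcons2 [:: x; l]) eqxx (subseq_rcons2 [:: x]) eqxx sub1seq.
  have: x \in rcons w l by rewrite rgf_mem // max_w x_gt0 ltnW.
  by rewrite mem_rcons inE (ltn_eqF ltxl).
split; first by rewrite lexl (leq_trans l_gt0).
apply/avoids121P => a b ltab; rewrite (subseq_rcons2 [:: a; b]).
case: eqP => [a_x|_]; last exact: av_w.
apply/negP => /mem_subseq/(_ _ (mem_last _ _)) /=; rewrite rgf_mem // max_w; lia.
Qed.

(** The maximum in the steps is written [last 0 w], which agrees with it on this class; the two
    steps are then the two possible unit steps at the end. *)
Lemma rb_gf_121 (n : nat) :
  (RB n [:: 1; 2; 1]%N = \prod_(1 <= i < n) (1 + 'X^i))%R.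
Proof.
have P_rcons w x y : rgf_avoiding [:: 1; 2; 1] (rcons (rcons w x) y) =
    rgf_avoiding [:: 1; 2; 1] (rcons w x) && unit_step x y.
  by rewrite !rgf_avoiding_121 sorted_rcons2 andbA; case: w.
apply: (@gf_recursive_class _ _ (fun w => rcons w (last 0 w))
                                (fun w => rcons w (last 0 w).+1)).
- by [].
- by rewrite /rb big_ord0.
- by rewrite /rb big_ord1.
- by move=> w; rewrite size_rcons.
- by move=> w; rewrite size_rcons.
- by move=> w s /rcons_inj[].
- by move=> w s /rcons_inj[].
- move=> w s _ _ _ /rcons_inj[-> last_w]; lia.
- case/lastP => // w x _ Pwx.
  by rewrite P_rcons Pwx last_rcons /unit_step leqnn leqnSn.
- case/lastP => // w x _ Pwx.
  by rewrite P_rcons Pwx last_rcons /unit_step leqnn leqnSn.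
- case/lastP => // w y; case/lastP: w => // w x _.
  rewrite P_rcons => /andP[Pwx /andP[lexy]]; exists (rcons w x) => //.
  rewrite last_rcons; move: lexy; rewrite leq_eqVlt => /predU1P[->|ltxy]; first by left.
  by right; congr rcons; lia.
- by case/lastP => // w x _ _; rewrite last_rcons rb_rcons_last.
- move=> w _; rewrite rgf_avoiding_121 => /andP[_ /max_unit_steps max_w].
  by apply: rb_rcons_gt => y w_y; rewrite ltnS -max_w (leq_bigmax_seq (F := id)).
Qed.

(** Unit steps are invariant under shifting, so the class can also be grown at the front. The second
    letter is 1 or 2, which tells whether the word comes from [g0] or [g1]. *)
Lemma ls_gf_121 (n : nat) :
  (LS n [:: 1; 2; 1]%N = \prod_(1 <= i < n) (1 + 'X^i))%R.
Proof.
have step_succ : {mono succn : x y / unit_step x y} by [].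
have P_g0 w : rgf_avoiding [:: 1; 2; 1] w -> rgf_avoiding [:: 1; 2; 1] (1 :: w).
  by rewrite !rgf_avoiding_121; case: w => //= x w /andP[/eqP->].
have P_g1 w : rgf_avoiding [:: 1; 2; 1] w ->
    rgf_avoiding [:: 1; 2; 1] (1 :: map succn w).
  rewrite !rgf_avoiding_121; case: w => //= x w /andP[/eqP->].
  by rewrite (mono_path step_succ).
apply: (@gf_recursive_class _ _ (cons 1) (fun w => 1 :: map succn w)).
- by [].
- by rewrite /ls big_ord0.
- by rewrite /ls big_ord1.
- by [].
- by move=> w; rewrite /= size_map.
- by move=> w s [].
- by move=> w s [] /(inj_map succn_inj).
- move=> w s w_neq0 /andP[rgf_w _] /andP[rgf_s _] [def_w].
  have [t def_t] := rgf_cons rgf_w w_neq0; have: 1 \in map succn s.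
    by rewrite def_w def_t mem_head.
  by rewrite (mem_map succn_inj) => /(rgf_gt0 rgf_s).
- by move=> w _; apply: P_g0.
- by move=> w _; apply: P_g1.
- case=> [|y [|x s]] // _; rewrite rgf_avoiding_121 /= => /andP[/eqP-> /andP[step1x xs]].
  have [x1|x_neq1] := eqVneq x 1.
    by exists (x :: s); [rewrite rgf_avoiding_121 /= x1 eqxx -x1 | left].
  have x2 : x = 2 by move: step1x; rewrite /unit_step; lia.
  (* The word is weakly increasing, so the letters after [x = 2] are at least 2 and lowering them
     can be undone. *)
  have s_gt0 : all (leq 1) s.
    have /(order_path_min leq_trans) : path leq x s.
      by apply: sub_path xs => a b /andP[].
    by apply: sub_all => a; apply: leq_trans; rewrite x2.
  have def_s : map succn (map predn s) = s.
    by rewrite -map_comp map_id_in // => a /(allP s_gt0) /= /prednK.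
  exists (1 :: map predn s); last by right; rewrite /= def_s x2.
  by rewrite rgf_avoiding_121 /= -(mono_path step_succ) def_s -x2.
- by move=> w _ Pw; have [/andP[? _] /andP[? _]] := (Pw, P_g0 _ Pw); apply: ls_cons1.
- by move=> w _ Pw; have [/andP[? _] /andP[? _]] := (Pw, P_g1 _ Pw); apply: ls_map_succ.
Qed.

Local Close Scope nat_scope.

Theorem theorem2p7 (n : nat) :
  [/\ LS n [:: 1; 1; 2]%N = LS n [:: 1; 2; 1]%N,
      LS n [:: 1; 2; 1]%N = RB n [:: 1; 2; 1]%N,
      RB n [:: 1; 2; 1]%N = RB n [:: 1; 2; 2]%N
    & RB n [:: 1; 2; 2]%N = \prod_(1 <= i < n) (1 + 'X^i)].
Proof. by rewrite ls_gf_112 ls_gf_121 rb_gf_121 rb_gf_122. Qed.
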